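(* Fix $m,m'\in\mathbb N$, $m+m'$ distinct vertices $v_1,\dots,v_m,v'_1,\dots,v'_{m'}\in V_n$, and sets $F,F'\subseteq V_n\cup V_n^{(2)}$, in the weighted rank-one inhomogeneous random graph $\mathbf G_n$ described in the context. For $r\in\mathbb N$ let $$\mathbf B_r=(B_r(v_i,\mathbf G_n),B_r(v_i,\mathbf G_n^F))_{i=1,\dots,m},\qquad \mathbf B'_r=(B_r(v'_{i'},\mathbf G_n),B_r(v'_{i'},\mathbf G_n^{F'}))_{i'=1,\dots,m'}.$$ There is an absolute constant $C>0$ such that for any $\ell\in\mathbb N$ $$\sup_{g,g'}\operatorname{Cov}_n(g(\mathbf B_\ell),g'(\mathbf B'_\ell))\le\min\Bigl\{\frac{\sum_{i,i'}(W_{v_i}+1)(W_{v'_{i'}}+1)}{n\vartheta}(\Gamma_{3,n}+1)(\Gamma_{2,n}+C)^{2\ell+1},1\Bigr\},$$ where the supremum is over all measurable functions $g,g'$ bounded by $1$ in absolute value. Equivalently, with $\mathcal V=\{v_1,\dots,v_m\}$ and $\mathcal V'=\{v'_1,\dots,v'_{m'}\}$, the first entry of the minimum is $\frac{(\|\mathcal V\|+|\mathcal V|)(\|\mathcal V'\|+|\mathcal V'|)}{n\vartheta}(\Gamma_{3,n}+1)(\Gamma_{2,n}+C)^{2\ell+1}$.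
   Context: **Graph model.** $V_n=\{1,\dots,n\}$, $V_n^{(2)}=\{\{u,v\}:u,v\in V_n,u\ne v\}$. Each $v\in V_n$ carries a possibly random connectivity weight $W_v\in(0,\infty)$. $\mathcal F_n=\sigma(W_1,\dots,W_n)$; $\mathbb P_n,\mathbb E_n,\operatorname{Cov}_n$ are conditional on $\mathcal F_n$. $\vartheta\in(0,\infty)$ satisfies $\frac1n\sum_{u\in V_n}W_u\to\vartheta$ in probability. Given $\mathcal F_n$, the edge indicators $X_e$, $e=\{u,v\}\in V_n^{(2)}$, are independent Bernoulli with success probability $\min(W_uW_v/(n\vartheta),1)$. $\mathbf G_n$ is the graph on $V_n$ with edges $\{e:X_e=1\}$, together with i.i.d. vertex weights $w_v\sim\mu_{V,n}$ and i.i.d. edge weights $w_e\sim\mu_{E,n}$ (on the non-negative reals), independent of everything else. **Resampling.** $(X',w')$ is an independent copy of $(X,w)$ given $\mathcal F_n$. For $F\subseteq V_n\cup V_n^{(2)}$, $\mathbf G_n^F$ is obtained from $\mathbf G_n$ by replacing $X_e$ by $X_e'$ for every edge $e\in F$ and $w_z$ by $w_z'$ for every $z\in F$ (vertex or edge). **Notation.** $B_r(v,\mathbf G)$ is the weighted subgraph of $\mathbf G$, rooted at $v$, formed by all paths starting at $v$ with at most $r$ edges. $\Gamma_{p,n}=\frac1{n\vartheta}\sum_{u\in V_n}W_u^p$. For $\mathcal U\subseteq V_n$, $\|\mathcal U\|=\sum_{u\in\mathcal U}W_u$. *)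

(* Defs.v *)
From HB Require Import structures.
From mathcomp Require Import all_boot all_order all_algebra.
From mathcomp Require Import all_classical all_reals all_analysis.
From mathcomp Require Import measurable_realfun.

Set Implicit Arguments.
Unset Strict Implicit.
Unset Printing Implicit Defensive.

Import Order.TTheory GRing.Theory Num.Theory.
Import numFieldNormedType.Exports.

Local Open Scope classical_set_scope.
Local Open Scope ring_scope.

(* [I -> T] equipped with the product (cylinder) sigma-algebra. *)
Definition pspace {d} (I : Type) (T : measurableType d) : Type := I -> T.

Definition cylinders {d} (I : Type) (T : measurableType d) : set_system (I -> T) :=
  \bigcup_(i in [set: I]) preimage_set_system setT (fun f : I -> T => f i) measurable.

HB.instance Definition _ d (I : Type) (T : measurableType d) :=
  Pointed.on (@pspace d I T).
HB.instance Definition _ d (I : Type) (T : measurableType d) :=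
  @isMeasurable.Build (sigma_display (@cylinders d I T)) (@pspace d I T)
    <<s @cylinders d I T >>
    (@sigma_algebra0 _ setT _) (@sigma_algebraC (I -> T) _)
    (@sigma_algebra_bigcup _ setT _).

Section Probability.
Context {d : measure_display} {T : measurableType d} {R : realType}.
Local Open Scope ereal_scope.

Definition mutually_independent (P : probability T R) (I : finType)
    (S : I -> set_system T) : Prop :=
  forall (J : {set I}) (A : I -> set T),
    (forall i, i \in J -> S i (A i)) ->
    P (\bigcap_(i in [set` J]) A i) = \prod_(i in J) P (A i).

(* [kappa] is a version of the conditional law of [Z] given the
   sub-sigma-algebra [F]. *)
Definition regular_conditional_law {d'} {S : measurableType d'}
    (P : probability T R) (F : set_system T) (Z : T -> S)
    (kappa : T -> probability S R) : Prop :=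
  (forall A, measurable A -> forall B : set (\bar R), measurable B ->
     F ((fun w => kappa w A) @^-1` B)) /\
  (forall A B, measurable A -> F B ->
     P (B `&` Z @^-1` A) = \int[P]_(w in B) kappa w A).

End Probability.

Section Graphs.
Context {R : realType} {n : nat}.

Definition edge : predArgType := {e : {set 'I_n} | #|e| == 2%N}.

(* V_n + V_n^(2), the carriers of the weights *)
Definition item : predArgType := ('I_n + edge)%type.

(* A weighted graph with vertices among [V_n]: each vertex and each potential
   edge comes with a presence flag and a weight, absent ones having weight 0. *)
Definition wgraph := pspace item (bool * R)%type.

(* The first component is the label of the root. *)
Definition rooted_wgraph := (nat * wgraph)%type.

Definition adj (G : wgraph) : rel 'I_n :=
  fun u v => [exists e : edge, (G (inr e)).1 && (val e == [set u; v]%SET)].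

Definition is_path (G : wgraph) (v : 'I_n) (p : seq 'I_n) : bool :=
  path (adj G) v p && uniq (v :: p).

(* [z] is a vertex, or an edge between consecutive vertices, of [v :: p]. *)
Definition on_path (v : 'I_n) (p : seq 'I_n) (z : item) : bool :=
  match z with
  | inl u => u \in v :: p
  | inr e => has (fun xy => val e == [set xy.1; xy.2]%SET) (zip (v :: p) p)
  end.

Definition ball (r : nat) (v : 'I_n) (G : wgraph) : rooted_wgraph :=
  (val v, fun z =>
     if [exists k : 'I_r.+1, exists p : k.-tuple 'I_n,
           is_path G v p && on_path v p z]
     then G z else (false, 0)).

(* A realization of ((X_e)_e, (w_z)_z). *)
Definition gdata := (pspace edge bool * pspace item R)%type.

(* A realization of ((X, w), (X', w')). *)
Definition config := (gdata * gdata)%type.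

Definition graph_of (x : gdata) : wgraph :=
  fun z => match z with
           | inl _ => (true, x.2 z)
           | inr e => if x.1 e then (true, x.2 z) else (false, 0)
           end.

Definition resample (F : {set item}) (c : config) : gdata :=
  (fun e => if inr e \in F then c.2.1 e else c.1.1 e,
   fun z => if z \in F then c.2.2 z else c.1.2 z).

Definition ball_pairs (r : nat) (F : {set item}) {m : nat} (v : m.-tuple 'I_n)
    (c : config) : m.-tuple (rooted_wgraph * rooted_wgraph)%type :=
  [tuple (ball r (tnth v i) (graph_of c.1),
          ball r (tnth v i) (graph_of (resample F c))) | i < m].

(* The sigma-algebras generated by the X_e, w_z, X'_e and w'_z. *)
Definition coord_sigma (i : (edge + item) + (edge + item)) : set_system config :=
  match i with
  | inl (inl e) => preimage_set_system setT (fun c : config => c.1.1 e) measurable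
  | inl (inr z) => preimage_set_system setT (fun c : config => c.1.2 z) measurable
  | inr (inl e) => preimage_set_system setT (fun c : config => c.2.1 e) measurable
  | inr (inr z) => preimage_set_system setT (fun c : config => c.2.2 z) measurable
  end.

Section Weights.
Variables (theta : R) (W : 'I_n -> R).

(* For e = {a, b} the product is W_a W_b. *)
Definition edge_prob (e : edge) : R :=
  Num.min ((\prod_(u in val e) W u) / (n%:R * theta)) 1.

Definition has_graph_law (muV muE : probability R R)
    (Q : probability config R) (x : config -> gdata) : Prop :=
  [/\ forall e, Q [set c | (x c).1 e] = (edge_prob e)%:E,
      forall v A, measurable A -> Q [set c | A ((x c).2 (inl v))] = muV A &
      forall e A, measurable A -> Q [set c | A ((x c).2 (inr e))] = muE A].

Definition Gam (p : nat) : R := (n%:R * theta)^-1 * \sum_u W u ^+ p.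

Definition wnorm (U : {set 'I_n}) : R := \sum_(u in U) W u.

End Weights.

(* sup over g, g' of Cov(g(B), g'(B')) under the law Q *)
Definition sup_cov (Q : probability config R) {d d' : measure_display}
    {S : measurableType d} {S' : measurableType d'}
    (B : config -> S) (B' : config -> S') : \bar R :=
  ereal_sup [set x | exists (g : S -> R) (g' : S' -> R),
    [/\ measurable_fun setT g, measurable_fun setT g',
        (forall b, `|g b| <= 1), (forall b, `|g' b| <= 1) &
        x = covariance Q (g \o B) (g' \o B')]].

End Graphs.

Arguments edge : clear implicits.
Arguments item : clear implicits.
Arguments gdata : clear implicits.
Arguments config : clear implicits.
Arguments wgraph : clear implicits.
Arguments rooted_wgraph : clear implicits.

(* The sequence of weighted rank-one inhomogeneous random graphs: for each n,
   [Z n] is the random ((X, w), (X', w')) and [kappa n] is a version of its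
   conditional law given F_n = sigma(W_1, .., W_n); it exists since [config] is
   standard Borel. P_n, E_n and Cov_n are taken under [kappa n w], so that
   suprema of Cov_n over test functions are pointwise in [w]. *)
Record rank_one_model {R : realType} {d : nat -> measure_display}
    {T : forall n, measurableType (d n)} (P : forall n, probability (T n) R)
    (theta : R) (W : forall n, 'I_n -> {RV (P n) >-> R})
    (muV muE : nat -> probability R R)
    (Z : forall n, {RV (P n) >-> config R n})
    (kappa : forall n, T n -> probability (config R n) R) : Prop := {
  theta_gt0 : 0 < theta ;
  weight_gt0 : forall n v w, 0 < W n v w ;
  weight_mean_cvg : forall eps : R, 0 < eps ->
    (fun n => P n [set w | eps < `|n%:R^-1 * (\sum_(u < n) W n u w) - theta|])
      @ \oo --> 0%E ;
  muV_ge0 : forall n, muV n `[0, +oo[%classic = 1%E ;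
  muE_ge0 : forall n, muE n `[0, +oo[%classic = 1%E ;
  kappa_conditional : forall n, regular_conditional_law (P n)
    (g_sigma_preimage (fun v => W n v : T n -> R)) (Z n) (kappa n) ;
  kappa_independent : forall n, {ae P n, forall w,
    mutually_independent (kappa n w) coord_sigma} ;
  kappa_law : forall n, {ae P n, forall w,
    has_graph_law theta (W n ^~ w) (muV n) (muE n) (kappa n w) fst /\
    has_graph_law theta (W n ^~ w) (muV n) (muE n) (kappa n w) snd}
}.

(* Main.v *)
(* Let c' be an independent copy of c = ((X, w), (X', w')), and let U be the set
   of vertices within distance l of the v_i in G or in G^F.  The items touching
   U form a stopping set that determines B, so that resampling them from c'
   gives a configuration c~ which is distributed as c and independent of B.
   Hence
     Cov(g(B), g'(B')) = E[g(B(c)) (g'(B'(c)) - g'(B'(c~)))].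
   The last difference vanishes unless there are two disjoint simple paths of
   length at most l, from some v_i in G or G^F and from some v'_j in G or
   G^{F'}, whose endpoints are joined by an edge present in X or X' of c or c'.
   All these edges are distinct, so for given paths the probability is at most
   the product of the W_x W_y / (n theta); the sum over all paths is at most
   16 W_{v_i} W_{v'_j} (1 + Gamma_2)^{2l} / (n theta), and C = 32 works. *)
Require Import Defs.
From HB Require Import structures.
From mathcomp Require Import all_boot all_order all_algebra.
From mathcomp Require Import all_classical all_reals all_analysis.
From mathcomp Require Import measurable_realfun.
From mathcomp Require Import ring lra.

Set Implicit Arguments.
Unset Strict Implicit.
Unset Printing Implicit Defensive.

Import Order.TTheory GRing.Theory Num.Theory.
Import numFieldNormedType.Exports.

Local Open Scope classical_set_scope.
Local Open Scope ring_scope.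

(** * Deterministic part: walks, explored regions and contact paths *)

Fixpoint walks (n l : nat) : seq (seq 'I_n) :=
  if l is l'.+1 then [::] :: [seq x :: p | x <- enum 'I_n, p <- walks n l']
  else [:: [::]].

Lemma mem_walks n l (p : seq 'I_n) : (p \in walks n l) = (size p <= l)%N.
Proof.
elim: l p => [|l IHl] [|x p] //=; rewrite in_cons /=.
apply/allpairsP/idP => [[[y q] /= [_ qw [_ ->]]]|pl]; first by rewrite ltnS -IHl.
by exists (x, p); rewrite /= mem_enum IHl.
Qed.

Lemma path_shorten (T : eqType) (e : rel T) (x : T) (p : seq T) :
  path e x p -> exists p', [/\ path e x p', uniq (x :: p'), last x p' = last x p,
                             (size p' <= size p)%N & {subset p' <= p}].
Proof.
case/shortenP => p' px' ux' sub; exists p'; split => //.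
apply: uniq_leq_size => //; by case/andP: ux'.
Qed.

Section Combinatorics.
Context {R : realType} {n : nat}.
Implicit Types (G : wgraph R n) (U : {set 'I_n}) (z : item n).
Implicit Types (D F : {set item n}).

(** One endpoint suffices for an edge, so that the presence or absence of the edges leaving [U] is
    recorded too; this makes an explored region recoverable from the items touching it. *)
Definition touches U z : bool :=
  match z with
  | inl u => u \in U
  | inr e => [exists u in U, u \in val e]
  end.

(** The closed ball of radius [l] in graph distance. Walks may repeat vertices here, unlike in
    [is_path]; every walk shortens to a simple path with the same ends. *)
Definition reach (l : nat) (v : 'I_n) G : {set 'I_n} :=
  [set u | has (fun p => path (adj G) v p && (last v p == u)) (walks n l)].

Lemma reachP l v G u :
  reflect (exists p, [/\ (size p <= l)%N, path (adj G) v p & last v p = u])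
          (u \in reach l v G).
Proof.
rewrite inE; apply: (iffP hasP) => [[p]|[p [sp pp <-]]].
  by rewrite mem_walks => sp /andP[pp /eqP <-]; exists p.
by exists p; rewrite ?mem_walks// pp eqxx.
Qed.

Lemma path_reach l v G p u : (size p <= l)%N -> path (adj G) v p ->
  u \in v :: p -> u \in reach l v G.
Proof.
move=> sp pp; rewrite in_cons => /orP[/eqP->|up].
  by apply/reachP; exists [::].
case/path.splitP: up sp pp => p1 p2; rewrite size_cat cat_path => sp /andP[pp _].
apply/reachP; exists (rcons p1 u); split => //; last by rewrite last_rcons.
exact: leq_trans (leq_addr _ _) sp.
Qed.

Lemma adj_sym G : symmetric (adj G).
Proof. by move=> x y; rewrite /adj; apply: eq_existsb => e; rewrite finset.setUC. Qed.

Lemma adj_touches U G G' u x : (forall z, touches U z -> G z = G' z) ->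
  u \in U -> adj G u x = adj G' u x.
Proof.
move=> GG uU; apply: eq_existsb => e; case: (boolP (val e == _)) => [/eqP ee|].
  rewrite !andbT GG//; apply/existsP; exists u.
  by rewrite uU ee !inE eqxx.
by rewrite !andbF.
Qed.

(** Each edge of the walk starts at a vertex that the preceding part has reached, hence touches the
    reach set. The induction removes the last vertex, because the prefix must already be a path in
    [G]. *)
Lemma path_touches l v G G' p : (size p <= l)%N ->
  (forall z, touches (reach l v G) z -> G z = G' z) ->
  path (adj G) v p = path (adj G') v p.
Proof.
move=> + GG; elim/last_ind: p => // p x IHp; rewrite size_rcons => sp.
rewrite !rcons_path -IHp ?(ltnW sp)//; case: (boolP (path _ _ _)) => //= pp.
apply: adj_touches GG _; exact: (path_reach (ltnW sp) pp (mem_last _ _)).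
Qed.

Lemma reach_touches l v G G' :
  (forall z, touches (reach l v G) z -> G z = G' z) ->
  reach l v G = reach l v G'.
Proof.
move=> GG; apply/setP => u; rewrite !inE; apply: eq_in_has => p.
by rewrite mem_walks => sp; rewrite (path_touches sp GG).
Qed.

Lemma mem_zip_path (T : eqType) (v : T) p xy : xy \in zip (v :: p) p -> xy.1 \in v :: p.
Proof.
elim: p v => //= y p IHp v; rewrite inE => /orP[/eqP->|/IHp h].
  by rewrite inE eqxx.
by rewrite h orbT.
Qed.

Lemma ball_touches l v G G' :
  (forall z, touches (reach l v G) z -> G z = G' z) ->
  Defs.ball l v G = Defs.ball l v G'.
Proof.
move=> GG; congr pair; apply/funext => z.
have -> : [exists k : 'I_l.+1, exists p : k.-tuple 'I_n,
             is_path G' v p && on_path v p z] =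
          [exists k : 'I_l.+1, exists p : k.-tuple 'I_n,
             is_path G v p && on_path v p z].
  apply: eq_existsb => k; apply: eq_existsb => p.
  by rewrite /is_path (@path_touches l v G G')// size_tuple -ltnS.
case: ifPn => // /existsP[k /existsP[p /andP[/andP[pp _] zp]]].
apply: GG; have sp : (size p <= l)%N by rewrite size_tuple -ltnS.
case: z zp => [u|e] /=; first exact: path_reach.
case/hasP => -[x y] /mem_zip_path/= xp /eqP ee.
apply/existsP; exists x; rewrite (path_reach sp pp xp)//= ee.
by rewrite !inE eqxx.
Qed.

(** While [resample] chooses between the two halves of one configuration, this combines two
    configurations: the data of an item and its primed version move together. *)
Definition mix (D : {set item n}) (a b : config R n) : config R n :=
  ((fun e => if inr e \in D then b.1.1 e else a.1.1 e,
    fun z => if z \in D then b.1.2 z else a.1.2 z),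
   (fun e => if inr e \in D then b.2.1 e else a.2.1 e,
    fun z => if z \in D then b.2.2 z else a.2.2 z)).

Definition bit (F : {set item n}) (e : edge n) (c : config R n) : bool :=
  if inr e \in F then c.2.1 e else c.1.1 e.

Definition graphF (F : {set item n}) (c : config R n) : wgraph R n :=
  graph_of (resample F c).

Lemma graphF0 c : graphF finset.set0 c = graph_of c.1.
Proof.
case: c => -[X w] [X' w']; apply/funext => -[u|e];
by rewrite /graphF /graph_of /resample /= !inE.
Qed.

Lemma adj_graphF F c x y :
  adj (graphF F c) x y = [exists e, bit F e c && (val e == [set x; y]%SET)].
Proof. by apply: eq_existsb => e; rewrite /graphF /graph_of /bit/=; case: ifP. Qed.

(** A Boolean switch between G_n (nothing resampled, see [graphF0]) and G_n^F, so that both graphs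
    are handled by one argument. *)
Definition only_if (s : bool) (F : {set item n}) : {set item n} :=
  if s then F else finset.set0.

Definition ball_region l m F (v : m.-tuple 'I_n) (c : config R n) : {set 'I_n} :=
  (\bigcup_(i < m) \bigcup_(s : bool) reach l (tnth v i) (graphF (only_if s F) c))%SET.

Definition items_of U : {set item n} := [set z | touches U z]%SET.

Lemma graphF_mix F D (a b : config R n) z : z \notin D ->
  graphF F (mix D a b) z = graphF F a z.
Proof.
move=> zD; case: z zD => [u|e] /negbTE zD;
by rewrite /graphF /graph_of /resample /mix/= zD.
Qed.

Lemma graphF_mixC F D (a b : config R n) z : z \in D ->
  graphF F (mix D a b) z = graphF F b z.
Proof.
move=> zD; case: z zD => [u|e] zD;
by rewrite /graphF /graph_of /resample /mix/= zD.
Qed.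

Lemma ball_pairsE l F m (v : m.-tuple 'I_n) (c : config R n) :
  ball_pairs l F v c = [tuple (Defs.ball l (tnth v i) (graphF (only_if false F) c),
                               Defs.ball l (tnth v i) (graphF (only_if true F) c)) | i < m].
Proof. by rewrite /only_if graphF0. Qed.

(** The stopping set property: the exploration consults only items touching the region it ends with,
    so agreement on these items forces the same region and the same balls. *)
Lemma ball_region_touches l F m (v : m.-tuple 'I_n) (c c' : config R n) :
  (forall s z, touches (ball_region l F v c) z ->
     graphF (only_if s F) c z = graphF (only_if s F) c' z) ->
  ball_region l F v c = ball_region l F v c' /\
  ball_pairs l F v c = ball_pairs l F v c'.
Proof.
move=> cc; have {}cc i s z : touches (reach l (tnth v i) (graphF (only_if s F) c)) z ->
    graphF (only_if s F) c z = graphF (only_if s F) c' z.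
  have sub u : u \in reach l (tnth v i) (graphF (only_if s F) c) ->
      u \in ball_region l F v c.
    by move=> ur; apply/bigcupP; exists i => //; apply/bigcupP; exists s.
  move=> tz; apply: cc; case: z tz => [u|e] /=; first exact: sub.
  by case/existsP => u /andP[/sub us ue]; apply/existsP; exists u; rewrite us.
split.
  by apply: eq_bigr => i _; apply: eq_bigr => s _; apply: reach_touches (cc i s).
rewrite !ball_pairsE; apply: eq_from_tnth => i; rewrite !tnth_mktuple.
by congr pair; apply: ball_touches (cc i _).
Qed.

(** The two configurations agree on the items touching [U]. Whichever of them has region [U], the
    stopping set property transfers it to the other. *)
Lemma ball_region_mix l F m (v : m.-tuple 'I_n) U (c c' : config R n) :
  (ball_region l F v (mix (~: items_of U)%SET c c') == U) = (ball_region l F v c == U).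
Proof.
have mz s z : touches U z -> graphF (only_if s F) c z =
    graphF (only_if s F) (mix (~: items_of U) c c') z.
  by move=> tz; rewrite graphF_mix// !inE tz.
apply/eqP/eqP => UE; have := @ball_region_touches l F m v.
  by move=> /(_ (mix (~: items_of U) c c') c)[|<- //]; rewrite UE => s z /mz.
by move=> /(_ c (mix (~: items_of U) c c'))[|<- //]; rewrite UE => s z /mz.
Qed.

Lemma ball_pairs_mix l F m (v : m.-tuple 'I_n) U (c c' : config R n) :
  ball_region l F v c = U ->
  ball_pairs l F v (mix (~: items_of U)%SET c c') = ball_pairs l F v c.
Proof.
move=> UE; apply/esym; apply: (ball_region_touches _).2; rewrite UE => s z tz.
by rewrite graphF_mix// !inE tz.
Qed.

(* Resampling no item, resp. every item, reads off the indicators X_e, resp.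
   X'_e: [F3] ranges over these two cases below, and [o] tells whether the edge
   joining the two disjoint paths is looked up in [c] or in its copy [c']. *)
Definition contact_path F1 F2 F3 (o : bool) (v v' : 'I_n) (p p' : seq 'I_n)
    (c c' : config R n) : bool :=
  [&& uniq ((v :: p) ++ (v' :: p')), path (adj (graphF F1 c)) v p,
      path (adj (graphF F2 c)) v' p' &
      adj (graphF F3 (if o then c else c')) (last v p) (last v' p')].

Definition contact l F F' m m' (v : m.-tuple 'I_n) (v' : m'.-tuple 'I_n)
    (c c' : config R n) : Prop :=
  exists (i : 'I_m) (j : 'I_m') (s s' t o : bool) (p p' : seq 'I_n),
    [/\ (size p <= l)%N, (size p' <= l)%N &
        contact_path (only_if s F) (only_if s' F') (only_if t [set: item n]%SET) o
          (tnth v i) (tnth v' j) p p' c c'].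

(** Each edge of a partially resampled graph is present in X or in X', so the joining edge of a
    contact needs only these two cases, whatever [F] is. *)
Lemma adj_bits F (c : config R n) x y : adj (graphF F c) x y ->
  exists t, adj (graphF (only_if t [set: item n]%SET) c) x y.
Proof.
rewrite adj_graphF => /existsP[e /andP[be ee]].
exists (inr e \in F); rewrite adj_graphF; apply/existsP; exists e; rewrite ee andbT.
by move: be; rewrite /bit /only_if; case: ifP; rewrite inE.
Qed.

(** Without contact, the exploration from the v'_j stays outside the region [U] of the v_i, and
    every edge from it into [U] is absent both before and after the exchange, so the exchange is
    invisible to it. *)
Lemma ball_pairs_no_contact l F F' m m' (v : m.-tuple 'I_n) (v' : m'.-tuple 'I_n)
    (c c' : config R n) : uniq (v ++ v') -> ~ contact l F F' v v' c c' ->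
  ball_pairs l F' v' (mix (items_of (ball_region l F v c)) c c') =
  ball_pairs l F' v' c.
Proof.
move=> uvv noc; set U := ball_region l F v c.
have vv' i j : tnth v i != tnth v' j.
  move: uvv; rewrite cat_uniq => /and3P[_ /hasPn/= h _].
  by apply: contraTneq (mem_tnth i v) => ->; apply: h; exact: mem_tnth.
have pathU x : x \in U -> exists i s p, [/\ (size p <= l)%N, uniq (tnth v i :: p),
    path (adj (graphF (only_if s F) c)) (tnth v i) p, last (tnth v i) p = x &
    {subset tnth v i :: p <= U}].
  case/bigcupP => i _ /bigcupP[s _] /reachP[p0 [sp0 /path_shorten]].
  move=> [p [pp up <- sp _]] <-; exists i, s, p.
  have {}sp := leq_trans sp sp0; split => // y yp.
  by apply/bigcupP; exists i => //; apply/bigcupP; exists s => //; apply: path_reach yp.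
(* A simple path inside [U] and a shortened path avoiding [U] are disjoint, so an edge between their
   ends would be a contact. *)
have noadj x j s' q t o : x \in U -> (size q <= l)%N ->
    path (adj (graphF (only_if s' F') c)) (tnth v' j) q ->
    (forall y, y \in tnth v' j :: q -> y \notin U) ->
    adj (graphF (only_if t [set: item n]%SET) (if o then c else c')) x (last (tnth v' j) q) = false.
  move=> /pathU[i [s [p [sp up pp <- pU]]]] sq0 /path_shorten[q' [pq' uq' <- sq sub]] qU.
  apply/negbTE/negP => axy; apply: noc; exists i, j, s, s', t, o, p, q'.
  split => //; first exact: leq_trans sq sq0.
  rewrite /contact_path pp pq' axy cat_uniq up uq' andTb !andbT.
  apply/hasPn => y yq; apply/negP => /pU; apply/negP/qU.
  by move: yq; rewrite !in_cons => /orP[->//|/sub ->]; rewrite orbT.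
(* By [vv'], a path from v_i reaching v'_j has at least one edge. Cutting off the last one leaves a
   contact in which the second path is empty. *)
have v'U j : tnth v' j \notin U.
  apply/negP => /pathU[i [s [p []]]]; case/lastP: p => [|p y].
    by move=> _ _ _ /= /eqP; rewrite (negbTE (vv' i j)).
  rewrite size_rcons last_rcons => sp up + yv _; rewrite {y}yv in up *.
  rewrite rcons_path => /andP[pp /adj_bits[t aj]].
  apply: noc; exists i, j, s, true, t, true, p, [::].
  by split; rewrite ?(ltnW sp)// /contact_path pp aj cats1 rcons_cons up.
(* Induction along the path: its first edge into [U] would contradict [noadj], read in [c]
   itself. *)
have qU j s' q : (size q <= l)%N ->
    path (adj (graphF (only_if s' F') c)) (tnth v' j) q ->
    forall y, y \in tnth v' j :: q -> y \notin U.
  elim/last_ind: q => [_ _ y|q y IHq]; first by rewrite inE => /eqP->.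
  rewrite size_rcons rcons_path => sq /andP[pq yq] x.
  rewrite -rcons_cons mem_rcons in_cons => /orP[/eqP{x}->|]; last first.
    by apply: IHq => //; exact: ltnW.
  apply/negP => yU; have [t] := adj_bits yq.
  rewrite adj_sym (noadj y j s' q t true)//; first exact: ltnW.
  by apply: IHq => //; exact: ltnW.
(* Only an edge with one end in [U] and the other outside can be affected. Applying [noadj] to all
   four choices of [t] and [o] makes it absent in X and X' of both [c] and [c']; absent edges have
   weight 0, so the two labels coincide. *)
have same j s' z : touches (reach l (tnth v' j) (graphF (only_if s' F') c)) z ->
    graphF (only_if s' F') c z =
    graphF (only_if s' F') (mix (items_of U) c c') z.
  case: (boolP (z \in items_of U)) => [|/graphF_mix-> //].
  rewrite inE; case: z => [u uU /reachP[q [sq pq lq]]|e].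
    by have := qU _ _ _ sq pq u; rewrite -lq mem_last lq (uU : u \in U) => /(_ isT).
  move=> eU; have eU' : inr e \in items_of U by rewrite inE.
  case/existsP => y /andP[/reachP[q [sq pq lq]] ye].
  have /existsP[x /andP[xU xe]] : [exists x in U, x \in val e] by exact: eU.
  have xy : x != y.
    apply: contraTneq xU => ->.
    by have := qU _ _ _ sq pq y; rewrite -lq mem_last => /(_ isT).
  have ee : val e = [set x; y]%SET.
    apply/esym/eqP; rewrite eqEcard (eqP (valP e)) cards2 xy andbT.
    by apply/fintype.subsetP => u; rewrite !inE => /orP[/eqP->|/eqP->].
  have nb t o : bit (only_if t [set: item n]%SET) e (if o then c else c') = false.
    have := noadj x j s' q t o xU sq pq (qU _ _ _ sq pq).
    rewrite lq adj_graphF => /existsPn/(_ e).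
    by rewrite ee eqxx andbT => /negbTE.
  rewrite graphF_mixC// /graphF /graph_of/=.
  have := (nb true true, nb true false, nb false true, nb false false).
  rewrite /bit /only_if !inE/= => -[[[-> ->] ->] ->].
  by rewrite !if_same.
apply/esym; rewrite !ball_pairsE; apply: eq_from_tnth => j; rewrite !tnth_mktuple.
by congr pair; apply: ball_touches (same j _).
Qed.

End Combinatorics.

(** * Expectations of bounded functions and decoupling of a covariance *)

Section Expectation.
Context {d} {T : measurableType d} {R : realType} (P : probability T R).

Lemma bounded_Lfun1 (f : T -> R) (M : R) : measurable_fun setT f ->
  (forall x, `|f x| <= M) -> f \in Lfun P 1.
Proof.
move=> mf fM; apply/Lfun1_integrable; apply: measurable_bounded_integrable => //.
  by rewrite (le_lt_trans (probability_le1 _ _)) ?ltry.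
by exists M; split; rewrite ?num_real// => y My x _ /=; exact: le_trans (fM x) (ltW My).
Qed.

Lemma expectation_mono (f g : T -> R) : f \in Lfun P 1 -> g \in Lfun P 1 ->
  (forall x, f x <= g x) -> ('E_P[f] <= 'E_P[g])%E.
Proof.
move=> /Lfun1_integrable mf /Lfun1_integrable mg fg.
by rewrite unlock; apply: le_integral => // x _; rewrite lee_fin.
Qed.

Lemma Lfun1_bigsum (I : Type) (r : seq I) (F : I -> T -> R) :
  (forall i, F i \in Lfun P 1) -> (fun x => \sum_(i <- r) F i x) \in Lfun P 1.
Proof.
move=> F1; apply/Lfun1_integrable.
rewrite (_ : _ \o _ = (fun x => \sum_(i <- r) (F i x)%:E)%E); last first.
  by apply/funext => x /=; rewrite sumEFin.
by apply: integrable_sum => // i _; apply/(Lfun1_integrable P _).1.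
Qed.

Lemma expectation_bigsum (I : Type) (r : seq I) (F : I -> T -> R) :
  (forall i, F i \in Lfun P 1) ->
  ('E_P[fun x => (\sum_(i <- r) F i x)%R] = \sum_(i <- r) 'E_P[F i])%E.
Proof.
move=> F1; elim: r => [|i r IHr].
  by under eq_fun do rewrite big_nil; rewrite big_nil (expectation_cst P 0).
rewrite big_cons -IHr -expectationD ?Lfun1_bigsum//.
by congr expectation; apply/funext => x; rewrite big_cons.
Qed.

End Expectation.

Section Decoupling.
Context {d} {T : measurableType d} {R : realType} (Q : probability T R).
Local Notation QQ := (Q \x Q)%E.

Lemma expectation_prodM (f h : T -> R) :
  measurable_fun setT f -> measurable_fun setT h ->
  (forall x, `|f x| <= 1) -> (forall x, `|h x| <= 1) ->
  ('E_QQ[fun x => (f x.1 * h x.2)%R] = 'E_Q[f] * 'E_Q[h])%E.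
Proof.
move=> mf mh f1 h1.
have fL := bounded_Lfun1 Q mf f1; have hL := bounded_Lfun1 Q mh h1.
have fhL : (fun x => f x.1 * h x.2) \in Lfun QQ 1.
  apply: (@bounded_Lfun1 _ _ _ _ _ 1) => [|x]; last by rewrite normrM mulr_ile1.
  by apply: measurable_funM; apply: measurableT_comp.
transitivity (\int[QQ]_x (f x.1 * h x.2)%:E)%E; first by rewrite unlock.
rewrite -integral12_prod_meas1; last exact/(Lfun1_integrable QQ _).1.
transitivity (\int[Q]_x ((f x)%:E * 'E_Q[h]))%E.
  apply: eq_integral => x _; rewrite /fubini_F/= unlock.
  under eq_integral do rewrite EFinM.
  by rewrite integralZl//; exact/Lfun1_integrable.
rewrite -(fineK (expectation_fin_num hL)) integralZr//; last exact/Lfun1_integrable.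
by rewrite unlock.
Qed.

Variables (I : finType) (reg : T -> I) (keep renew : I -> T * T -> T).
Hypothesis mreg : forall u, measurable (reg @^-1` [set u]).
Hypothesis mrenew : forall u, measurable_fun setT (renew u).
Hypothesis mkeep : forall u, measurable_fun setT (keep u).
Hypothesis keep_renew : forall u A, measurable A ->
  QQ ((fun x => (keep u x, renew u x)) @^-1` A) = QQ A.
Hypothesis reg_keep : forall u x, (reg (keep u x) == u) = (reg x.1 == u).

(** Write E[f] E[h] as an expectation over two independent copies and split by the value [u] of the
    region. For fixed [u], the map ([keep u], [renew u]) preserves the product law, the event that
    the region is [u], and [f] on that event. *)
Lemma covariance_decoupling (f h : T -> R) :
  measurable_fun setT f -> measurable_fun setT h ->
  (forall x, `|f x| <= 1) -> (forall x, `|h x| <= 1) ->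
  (forall u x, reg x.1 = u -> f (keep u x) = f x.1) ->
  (covariance Q f h = 'E_QQ[fun x => (f x.1 * (h x.1 - h (renew (reg x.1) x)))%R])%E
  /\ (fun x => f x.1 * (h x.1 - h (renew (reg x.1) x))) \in Lfun QQ 1.
Proof.
move=> mf mh f1 h1 fkeep.
pose ind u (x : T) : R := (reg x == u)%:R.
have mind u : measurable_fun setT (ind u).
  rewrite (_ : ind u = \1_(reg @^-1` [set u])); last first.
    apply/funext => x; rewrite indicE; congr (nat_of_bool _)%:R.
    by apply/eqP/idP; rewrite inE.
  exact: measurable_indic.
have ind1 u x : `|ind u x| <= 1 by rewrite /ind; case: eqP => _; rewrite ?normr1 ?normr0.
have mM (T' : T * T -> T) : measurable_fun setT T' -> measurable_fun setT (h \o T').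
  by move=> m; exact: measurableT_comp.
have fL := bounded_Lfun1 Q mf f1; have hL := bounded_Lfun1 Q mh h1.
have mfh : measurable_fun setT (f * h) by exact: measurable_funM.
have fh1 x : `|(f * h) x| <= 1 by rewrite normrM mulr_ile1.
have fhL := bounded_Lfun1 Q mfh fh1.
have mu_f u : measurable_fun setT (ind u * f) by exact: measurable_funM.
have uf1 u x : `|(ind u * f) x| <= 1 by rewrite normrM mulr_ile1.
have L1 : (fun x : T * T => (f * h) x.1) \in Lfun QQ 1.
  by apply: (@bounded_Lfun1 _ _ _ _ _ 1) => [|x]; [exact: measurableT_comp|].
have Lu u : (fun x => (ind u * f) x.1 * h (renew u x)) \in Lfun QQ 1.
  apply: (@bounded_Lfun1 _ _ _ _ _ 1) => [|x]; last by rewrite normrM mulr_ile1.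
  by apply: measurable_funM; [exact: measurableT_comp|exact: mM].
(* Splitting by the region turns the random map [renew (reg x.1)] into finitely many fixed ones; its
   measurability and its expectation are both obtained from this sum. *)
have sumE x : \sum_u (ind u * f) x.1 * h (renew u x) = f x.1 * h (renew (reg x.1) x).
  rewrite (bigD1 (reg x.1))//= big1 => [|u /negbTE ur].
    by rewrite addr0 /ind fctE eqxx mul1r.
  by rewrite /ind fctE eq_sym ur !mul0r.
have L2 : (fun x => f x.1 * h (renew (reg x.1) x)) \in Lfun QQ 1.
  apply: (@bounded_Lfun1 _ _ _ _ _ 1) => [|x]; last by rewrite normrM mulr_ile1.
  rewrite -(funext sumE); apply: measurable_sum => u.
  by apply: measurable_funM; [exact: measurableT_comp|exact: mM].
have -> : (fun x => f x.1 * (h x.1 - h (renew (reg x.1) x))) =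
    (fun x => (f * h) x.1) \- (fun x => f x.1 * h (renew (reg x.1) x)).
  by apply/funext => x /=; rewrite mulrBr.
split; last exact: rpredB.
rewrite expectationB// covarianceE//; congr (_ - _)%E.
  have := @expectation_prodM (f * h) (cst 1) mfh (measurable_cst _) fh1.
  rewrite expectation_cst mule1 => <- => [|x]; last by rewrite normr1.
  by congr expectation; apply/funext => x /=; rewrite mulr1.
rewrite -expectation_prodM//.
transitivity (\sum_u 'E_QQ[fun x => ((ind u * f) x.1 * h x.2)%R])%E.
  rewrite -expectation_bigsum => [|u]; last first.
    apply: (@bounded_Lfun1 _ _ _ _ _ 1) => [|x]; last by rewrite normrM mulr_ile1.
    by apply: measurable_funM; apply: measurableT_comp.
  congr expectation; apply/funext => x; rewrite (bigD1 (reg x.1))//= big1 => [|u /negbTE ur].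
    by rewrite addr0 /ind fctE eqxx mul1r.
  by rewrite /ind fctE eq_sym ur !mul0r.
rewrite -(funext sumE) expectation_bigsum//; apply: eq_bigr => u _.
pose phi x := (keep u x, renew u x).
have mphi : measurable_fun setT phi by exact: measurable_fun_pair.
pose k (x : T * T) := (ind u * f) x.1 * h x.2.
have mk : measurable_fun setT k.
  by apply: measurable_funM; apply: measurableT_comp.
have k1 x : `|k x| <= 1 by rewrite normrM mulr_ile1.
rewrite -/k; transitivity (\int[QQ]_x (k x)%:E)%E; first by rewrite unlock.
(* Change of variables: by [keep_renew], the law of [phi] under [QQ] is [QQ] again. *)
transitivity (\int[pushforward QQ phi]_x (k x)%:E)%E.
  by apply: eq_measure_integral => A mA _; exact/esym/keep_renew.
rewrite (@integral_pushforward _ _ _ _ _ phi)//=.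
- rewrite preimage_setT unlock; apply: eq_integral => x _; congr EFin; rewrite /k /phi/= /ind fctE reg_keep.
  by case: eqP => [ru|_]; rewrite ?mul0r// (fkeep _ _ ru).
- exact/measurable_EFinP.
- rewrite preimage_setT; apply/(Lfun1_integrable QQ _).1; apply: (@bounded_Lfun1 _ _ _ _ _ 1).
    exact: measurableT_comp.
  by move=> x; exact: k1.
Qed.

(** The decoupled integrand vanishes off the union of the [E k] and is at most 1 * (1 + 1) = 2 on
    it; the union bound concludes. *)
Lemma covariance_le_union (f h : T -> R) (K : finType) (E : K -> set (T * T)) :
  measurable_fun setT f -> measurable_fun setT h ->
  (forall x, `|f x| <= 1) -> (forall x, `|h x| <= 1) ->
  (forall u x, reg x.1 = u -> f (keep u x) = f x.1) ->
  (forall k, measurable (E k)) ->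
  (forall x, (forall k, ~ E k x) -> h (renew (reg x.1) x) = h x.1) ->
  (covariance Q f h <= \sum_k (2%:E * QQ (E k)))%E.
Proof.
move=> mf mh f1 h1 fkeep mE hE.
have [-> L] := covariance_decoupling mf mh f1 h1 fkeep.
have LE k : (2 \o* \1_(E k) : T * T -> R) \in Lfun QQ 1.
  apply: (@bounded_Lfun1 _ _ _ _ _ 2) => [|x].
    by apply: measurable_funM => //; exact: measurable_indic.
  by rewrite /= indicE ger0_norm ?mulr_ge0// -[leRHS]mul1r ler_pM// lern1 leq_b1.
apply: (@le_trans _ _ 'E_QQ[fun x => (\sum_k (2 \o* \1_(E k)) x)%R]%E).
  apply: expectation_mono => //; first exact: Lfun1_bigsum.
  move=> x; have E0 k : 0 <= (2 \o* \1_(E k)) x :> R.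
    by rewrite /= mulr_ge0// indicE.
  have [[k Ek]|nE] := pselect (exists k, E k x); last first.
    rewrite hE ?subrr ?mulr0 ?sumr_ge0// => k Ek; apply: nE.
    by exists k.
  rewrite (bigD1 k)//= ler_wpDr ?sumr_ge0// indicE mem_set// (mul1r 2).
  rewrite (le_trans (ler_norm _))// normrM -[leRHS]mul1r ler_pM//.
  by rewrite (le_trans (ler_normB _ _))// [leRHS](_ : 2 = 1 + 1)// lerD.
rewrite expectation_bigsum//; apply: lee_sum => k _.
rewrite expectationZl ?expectation_indic//.
apply: (@bounded_Lfun1 _ _ _ _ _ 1) => [|x]; first exact: measurable_indic.
by rewrite indicE ger0_norm// lern1 leq_b1.
Qed.

End Decoupling.

(** With a = E[f] and b = E[h], the inequality xy <= (x^2 + y^2) / 2 and f^2, h^2 <= 1 give (f -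
    a)(h - b) <= 1 + (a^2 + b^2)/2 - a f - b h. The right side has expectation 1 - (a^2 + b^2)/2. *)
Lemma covariance_le1 {d} {T : measurableType d} {R : realType} (Q : probability T R)
    (f h : T -> R) : measurable_fun setT f -> measurable_fun setT h ->
  (forall x, `|f x| <= 1) -> (forall x, `|h x| <= 1) -> (covariance Q f h <= 1)%E.
Proof.
move=> mf mh f1 h1.
have fL := bounded_Lfun1 Q mf f1; have hL := bounded_Lfun1 Q mh h1.
rewrite unlock; set a := fine 'E_Q[f]%E; set b := fine 'E_Q[h]%E.
have aE : ('E_Q[f] = a%:E)%E by rewrite fineK// expectation_fin_num.
have bE : ('E_Q[h] = b%:E)%E by rewrite fineK// expectation_fin_num.
have aL : a \o* f \in Lfun Q 1 by rewrite Lfun_scale.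
have bL : b \o* h \in Lfun Q 1 by rewrite Lfun_scale.
pose c : T -> R := cst (1 + (a ^+ 2 + b ^+ 2) / 2).
have cL : c \in Lfun Q 1 by rewrite Lfun_cst.
pose g : T -> R := c \- a \o* f \- b \o* h.
apply: (@le_trans _ _ 'E_Q[g]%E); last first.
  rewrite /g !expectationB ?rpredB// !expectationZl// aE bE expectation_cst.
  rewrite -!EFinM -!EFinB lee_fin.
  have := sqr_ge0 a; have := sqr_ge0 b; rewrite !expr2; lra.
apply: expectation_mono => [||x]; last first.
- have sqr1 (y : R) : `|y| <= 1 -> y ^+ 2 <= 1 by rewrite -real_normK ?num_real// => ?; rewrite exprn_ile1.
  have := sqr1 _ (f1 x); have := sqr1 _ (h1 x).
  have := sqr_ge0 ((f x - a) - (h x - b)).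
  rewrite /g /c /= fctE /= !expr2 => h1x h2x h3x; lra.
- by rewrite !rpredB.
apply: (@bounded_Lfun1 _ _ _ _ _ ((1 + `|a|) * (1 + `|b|))) => [|x].
  by apply: measurable_funM; apply: measurable_funB.
by rewrite normrM ler_pM// (le_trans (ler_normB _ _))// lerD.
Qed.

(** * Measurability of balls, regions and path events *)

Section Measurability.

Lemma measurable_fun_pspace {d d'} (T : measurableType d) (I : Type)
    (U : measurableType d') (f : T -> pspace I U) :
  (forall i, measurable_fun setT (fun x => f x i)) -> measurable_fun setT f.
Proof.
move=> mf; have := @measurability _ _ T (pspace I U) setT f (@cylinders _ I U) erefl.
apply.
move=> _ [_ [i _ [B mB <-]] <-]; have := mf i measurableT B mB.
by rewrite !setTI.
Qed.

Lemma measurable_pspace_proj {d} (I : Type) (U : measurableType d) (i : I) :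
  measurable_fun setT (fun f : pspace I U => f i).
Proof.
by move=> _ B mB; apply: sub_sigma_algebra; exists i => //; exists B.
Qed.

Context {d} {T : measurableType d}.

Lemma measurable_fun_has (I : Type) (r : seq I) (b : I -> T -> bool) :
  (forall i, measurable_fun setT (b i)) ->
  measurable_fun setT (fun x => has (b^~ x) r).
Proof.
move=> mb; elim: r => [|i r IHr] /=; first exact: measurable_cst.
exact: measurable_or.
Qed.

Lemma measurable_fun_all (I : Type) (r : seq I) (b : I -> T -> bool) :
  (forall i, measurable_fun setT (b i)) ->
  measurable_fun setT (fun x => all (b^~ x) r).
Proof.
move=> mb; elim: r => [|i r IHr] /=; first exact: measurable_cst.
exact: measurable_and.
Qed.

Lemma measurable_fun_exists (I : finType) (b : I -> T -> bool) :
  (forall i, measurable_fun setT (b i)) ->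
  measurable_fun setT (fun x => [exists i, b i x]).
Proof.
move=> mb; rewrite (_ : (fun x => _) = fun x => has (b^~ x) (enum I)).
  exact: measurable_fun_has.
apply/funext => x; apply/existsP/hasP => [[i bi]|[i _ bi]]; last by exists i.
by exists i; rewrite ?mem_enum.
Qed.

Lemma measurable_fun_forall (I : finType) (b : I -> T -> bool) :
  (forall i, measurable_fun setT (b i)) ->
  measurable_fun setT (fun x => [forall i, b i x]).
Proof.
move=> mb; rewrite (_ : (fun x => _) = fun x => all (b^~ x) (enum I)).
  exact: measurable_fun_all.
apply/funext => x; apply/forallP/allP => [bi i _|bi i]; first exact: bi.
by apply: bi; rewrite mem_enum.
Qed.

Lemma measurable_preim_true (b : T -> bool) : measurable_fun setT b ->
  measurable [set x | b x].
Proof.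
move=> mb; rewrite (_ : [set x | b x] = setT `&` b @^-1` [set true]).
  exact: mb.
by rewrite setTI.
Qed.

End Measurability.

Section ConfigMeasurability.
Context {R : realType} {n : nat} {d} {T : measurableType d}.
Implicit Types (c : T -> config R n) (G : T -> wgraph R n) (F D : {set item n}).

Lemma measurable_fun_configP c : measurable_fun setT c <->
  ((forall e, measurable_fun setT (fun x => (c x).1.1 e)) /\
   (forall z, measurable_fun setT (fun x => (c x).1.2 z))) /\
  ((forall e, measurable_fun setT (fun x => (c x).2.1 e)) /\
   (forall z, measurable_fun setT (fun x => (c x).2.2 z))).
Proof.
split=> [mc|[[m1 m2] [m3 m4]]]; last first.
  apply/measurable_fun_pairP; split; apply/measurable_fun_pairP; split.
  - exact: (@measurable_fun_pspace _ _ T (edge n) bool (fun x => (c x).1.1) m1).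
  - exact: (@measurable_fun_pspace _ _ T (item n) R (fun x => (c x).1.2) m2).
  - exact: (@measurable_fun_pspace _ _ T (edge n) bool (fun x => (c x).2.1) m3).
  - exact: (@measurable_fun_pspace _ _ T (item n) R (fun x => (c x).2.2) m4).
have m1 := measurableT_comp measurable_fst mc.
have m2 := measurableT_comp measurable_snd mc.
split; split => i.
- exact: measurableT_comp (@measurable_pspace_proj _ (edge n) bool i)
    (measurableT_comp measurable_fst m1).
- exact: measurableT_comp (@measurable_pspace_proj _ (item n) R i)
    (measurableT_comp measurable_snd m1).
- exact: measurableT_comp (@measurable_pspace_proj _ (edge n) bool i)
    (measurableT_comp measurable_fst m2).
- exact: measurableT_comp (@measurable_pspace_proj _ (item n) R i)
    (measurableT_comp measurable_snd m2).
Qed.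

Lemma measurable_fun_mix D c c' : measurable_fun setT c -> measurable_fun setT c' ->
  measurable_fun setT (fun x => mix D (c x) (c' x)).
Proof.
move=> /measurable_fun_configP[[m1 m2] [m3 m4]].
move=> /measurable_fun_configP[[m1' m2'] [m3' m4']].
by apply/measurable_fun_configP; split; split => i; rewrite /mix/=; case: (_ \in D).
Qed.

Lemma measurable_fun_bit F e c : measurable_fun setT c ->
  measurable_fun setT (fun x => bit F e (c x)).
Proof.
by move=> /measurable_fun_configP[[m1 m2] [m3 m4]]; rewrite /bit; case: (_ \in F).
Qed.

Lemma measurable_fun_graphF F c : measurable_fun setT c ->
  forall z, measurable_fun setT (fun x => graphF F (c x) z).
Proof.
move=> mc; have mb e := measurable_fun_bit F e mc.
move: mc => /measurable_fun_configP[[m1 m2] [m3 m4]].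
have mw z : measurable_fun setT (fun x => (true, (resample F (c x)).2 z)).
  by apply: measurable_fun_pair => //=; case: (z \in F).
case=> [u|e]; first exact: mw.
by apply: measurable_fun_ifT; [exact: mb|exact: mw|exact: measurable_cst].
Qed.

Definition bits_measurable G : Prop :=
  forall e, measurable_fun setT (fun x => (G x (inr e)).1).

Lemma bits_measurable_graphF F c : measurable_fun setT c ->
  bits_measurable (fun x => graphF F (c x)).
Proof.
move=> mc e; apply: measurableT_comp; first exact: measurable_fst.
exact: measurable_fun_graphF.
Qed.

Lemma measurable_fun_adj G u v : bits_measurable G ->
  measurable_fun setT (fun x => adj (G x) u v).
Proof.
move=> mG; apply: measurable_fun_exists => e.
by apply: measurable_and; [exact: mG|exact: measurable_cst].
Qed.

Lemma measurable_fun_path G v p : bits_measurable G ->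
  measurable_fun setT (fun x => path (adj (G x)) v p).
Proof.
move=> mG; elim: p v => [|y p IHp] v /=; first exact: measurable_cst.
by apply: measurable_and; [exact: measurable_fun_adj|exact: IHp].
Qed.

Lemma measurable_fun_reach G l v u : bits_measurable G ->
  measurable_fun setT (fun x => u \in reach l v (G x)).
Proof.
move=> mG; under eq_fun do rewrite inE.
apply: measurable_fun_has => p; apply: measurable_and.
  exact: measurable_fun_path.
exact: measurable_cst.
Qed.

Lemma measurable_ball_region l F m (v : m.-tuple 'I_n) c U : measurable_fun setT c ->
  measurable_fun setT (fun x => ball_region l F v (c x) == U).
Proof.
move=> mc; rewrite (_ : (fun x => _) = fun x => [forall u, [exists i, exists s,
    u \in reach l (tnth v i) (graphF (only_if s F) (c x))] == (u \in U)]).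
  apply: measurable_fun_forall => u.
  have mu : measurable_fun setT (fun x => [exists i, exists s,
      u \in reach l (tnth v i) (graphF (only_if s F) (c x))]).
    apply: measurable_fun_exists => i; apply: measurable_fun_exists => s.
    exact/measurable_fun_reach/bits_measurable_graphF.
  case: (u \in U); first by under eq_fun do rewrite eqb_id.
  by under eq_fun do rewrite eqbF_neg; exact: measurable_neg.
apply/funext => x.
have uE u : (u \in ball_region l F v (c x)) = [exists i, exists s,
    u \in reach l (tnth v i) (graphF (only_if s F) (c x))].
  apply/bigcupP/existsP => [[i _ /bigcupP[s _ us]]|[i /existsP[s us]]].
    by exists i; apply/existsP; exists s.
  by exists i => //; apply/bigcupP; exists s.
apply/eqP/forallP => [<- u|uU]; first by rewrite uE.
by apply/setP => u; rewrite uE (eqP (uU u)).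
Qed.

Lemma measurable_fun_ball l v G : (forall z, measurable_fun setT (fun x => G x z)) ->
  measurable_fun setT (fun x => Defs.ball l v (G x)).
Proof.
move=> mG; apply: measurable_fun_pair; first exact: measurable_cst.
apply: measurable_fun_pspace => z; apply: measurable_fun_ifT => //.
apply: measurable_fun_exists => k; apply: measurable_fun_exists => p.
apply: measurable_and; last exact: measurable_cst.
apply: measurable_and; last exact: measurable_cst.
apply: measurable_fun_path => e; exact: measurableT_comp (mG _).
Qed.

Lemma measurable_ball_pairs l F m (v : m.-tuple 'I_n) c : measurable_fun setT c ->
  measurable_fun setT (fun x => ball_pairs l F v (c x)).
Proof.
move=> mc; apply/measurable_fun_tnthP => i.
rewrite (_ : _ \o _ = fun x => (Defs.ball l (tnth v i) (graphF (only_if false F) (c x)),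
    Defs.ball l (tnth v i) (graphF (only_if true F) (c x)))); last first.
  by apply/funext => x; rewrite /comp ball_pairsE tnth_mktuple.
by apply: measurable_fun_pair; apply: measurable_fun_ball => z;
  exact: measurable_fun_graphF.
Qed.

Lemma measurable_contact_path F1 F2 F3 o v v' p p' c c' :
  measurable_fun setT c -> measurable_fun setT c' ->
  measurable [set x | contact_path F1 F2 F3 o v v' p p' (c x) (c' x)].
Proof.
move=> mc mc'; apply: measurable_preim_true; apply: measurable_and.
  exact: measurable_cst.
apply: measurable_and; first exact/measurable_fun_path/bits_measurable_graphF.
apply: measurable_and; first exact/measurable_fun_path/bits_measurable_graphF.
by case: o; exact/measurable_fun_adj/bits_measurable_graphF.
Qed.

End ConfigMeasurability.

(** * Exchanging items between two independent configurations *)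

Section Law.
Context {R : realType} {n : nat} (Q : probability (config R n) R).
Implicit Types (D F : {set item n}).
Local Notation QQ := (Q \x Q)%E.
Local Notation coord := ((edge n + item n) + (edge n + item n))%type.
Local Notation S := (@coord_sigma R n).

Definition item_of_coord (k : coord) : item n :=
  match k with
  | inl (inl e) | inr (inl e) => inr e
  | inl (inr z) | inr (inr z) => z
  end.

Lemma measurable_coord_sigma k A : S k A -> measurable A.
Proof.
have [[m1 m2] [m3 m4]] := (measurable_fun_configP id).1 (@measurable_id _ (config R n) setT).
by case: k => -[e|z] [B mB <-]; [exact: m1|exact: m2|exact: m3|exact: m4].
Qed.

Lemma coord_sigmaI k A B : S k A -> S k B -> S k (A `&` B).
Proof.
by case: k => -[e|z] [A' mA <-] [B' mB <-]; exists (A' `&` B');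
  rewrite ?preimage_setI ?setTI//; exact: measurableI.
Qed.

Lemma coord_sigmaT k : S k setT.
Proof. by case: k => -[e|z]; exists setT; rewrite ?preimage_setT ?setTI. Qed.

Lemma coord_sigma_mix k A D a b : S k A ->
  A (mix D a b) = A (if item_of_coord k \in D then b else a).
Proof.
by case: k => -[e|z] [A' mA <-]; rewrite !setTI /preimage/mix/=; case: (_ \in D).
Qed.

Hypothesis indep : mutually_independent Q S.

(** With [A k] in the sigma-algebra of coordinate [k], these are the sets whose probability
    independence determines; products of two of them form the pi-system used below. *)
Definition rectangle (A : coord -> set (config R n)) : set (config R n) :=
  [set c | forall k, A k c].

Lemma rectangleE A : rectangle A = \bigcap_(k in [set` [set: coord]%SET]) A k.
Proof.
by apply/seteqP; split=> [c Ac k _|c Ac k]; [exact: Ac|apply: Ac; rewrite /= inE].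
Qed.

Lemma measurable_rectangle A : (forall k, S k (A k)) -> measurable (rectangle A).
Proof.
move=> SA; rewrite rectangleE; apply: fin_bigcap_measurable => // k _.
exact: measurable_coord_sigma (SA k).
Qed.

Lemma probability_rectangle A : (forall k, S k (A k)) ->
  Q (rectangle A) = (\prod_k Q (A k))%E.
Proof.
by move=> SA; rewrite rectangleE indep//; apply: eq_bigl => k; rewrite inE.
Qed.

Lemma probability_rectangleX A B : (forall k, S k (A k)) -> (forall k, S k (B k)) ->
  QQ (rectangle A `*` rectangle B) = ((\prod_k Q (A k)) * (\prod_k Q (B k)))%E.
Proof.
move=> SA SB; rewrite -!probability_rectangle//.
by apply: product_measure1E; exact: measurable_rectangle.
Qed.

Definition rectangles : set_system (config R n * config R n) :=
  [set X | exists A B, [/\ forall k, S k (A k), forall k, S k (B k) &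
                           X = rectangle A `*` rectangle B]].

(** An event on one coordinate of one copy is a rectangle with all other sides full, so every
    coordinate map is measurable for the generated sigma-algebra, and hence so is the identity. *)
Lemma rectangles_generate E : measurable E -> <<s rectangles >> E.
Proof.
pose T' := g_sigma_algebraType rectangles.
have sub (A : set _) : rectangles A -> @measurable _ T' A by exact: sub_sigma_algebra.
pose only (k : coord) A k' : set (config R n) := if k' == k then A else setT.
have onlyS k A k' : S k A -> S k' (only k A k').
  by move=> SA; rewrite /only; case: eqP => [->//|_]; exact: coord_sigmaT.
have onlyE k A : rectangle (only k A) = A.
  apply/seteqP; split=> [c /(_ k)|c Ac k']; rewrite /only ?eqxx//.
  by case: eqP.
have rectT : rectangle (fun=> setT) = setT by apply/seteqP; split.
have fstT k A : S k A -> @measurable _ T' (fst @^-1` A).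
  move=> SA; apply: sub; exists (only k A), (fun=> setT).
  split=> [k'|k'|]; [exact: onlyS|exact: coord_sigmaT|].
  by rewrite onlyE rectT; apply/seteqP; split=> [x|x []].
have sndT k A : S k A -> @measurable _ T' (snd @^-1` A).
  move=> SA; apply: sub; exists (fun=> setT), (only k A).
  split=> [k'|k'|]; [exact: coord_sigmaT|exact: onlyS|].
  by rewrite onlyE rectT; apply/seteqP; split=> [x|x []].
suff mid : measurable_fun setT (id : T' -> config R n * config R n).
  by move=> mE; have := mid measurableT E mE; rewrite setTI.
apply/measurable_fun_pairP; split; apply/measurable_fun_configP;
  (do 2 split) => i _ B mB; rewrite setTI.
- by apply: (fstT (inl (inl i)) [set c | B (c.1.1 i)]); exists B; rewrite ?setTI.
- by apply: (fstT (inl (inr i)) [set c | B (c.1.2 i)]); exists B; rewrite ?setTI.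
- by apply: (fstT (inr (inl i)) [set c | B (c.2.1 i)]); exists B; rewrite ?setTI.
- by apply: (fstT (inr (inr i)) [set c | B (c.2.2 i)]); exists B; rewrite ?setTI.
- by apply: (sndT (inl (inl i)) [set c | B (c.1.1 i)]); exists B; rewrite ?setTI.
- by apply: (sndT (inl (inr i)) [set c | B (c.1.2 i)]); exists B; rewrite ?setTI.
- by apply: (sndT (inr (inl i)) [set c | B (c.2.1 i)]); exists B; rewrite ?setTI.
- by apply: (sndT (inr (inr i)) [set c | B (c.2.2 i)]); exists B; rewrite ?setTI.
Qed.

(** The map swaps the coordinates outside [D] between the two copies. On a product of rectangles
    this only permutes the factors of the probability; uniqueness of measures on a pi-system extends
    the equality to all [E]. *)
Lemma mix_invariant D E : measurable E ->
  QQ ((fun x => (mix (~: D)%SET x.1 x.2, mix D x.1 x.2)) @^-1` E) = QQ E.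
Proof.
set phi := fun x : config R n * config R n => _.
have mphi : measurable_fun setT phi.
  by apply: measurable_fun_pair; apply: measurable_fun_mix.
move=> mE; pose phi' := [the {mfun _ >-> _} of mfun_Sub (mem_set mphi)].
have -> : QQ (phi @^-1` E) = pushforward QQ phi' E by [].
apply: (g_sigma_algebra_measure_unique rectangles _ (fun=> setT)) => //.
- by move=> _ [A [B [SA SB ->]]]; apply: measurableX; exact: measurable_rectangle.
- move=> _; exists (fun=> setT), (fun=> setT).
  split=> [k|k|]; [exact: coord_sigmaT|exact: coord_sigmaT|].
  by apply/seteqP; split.
- by apply/seteqP; split=> // x _; exists 0%N.
- move=> _ _ [A [B [SA SB ->]]] [A' [B' [SA' SB' ->]]].
  exists (fun k => A k `&` A' k), (fun k => B k `&` B' k).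
  split=> [k|k|]; [exact: coord_sigmaI|exact: coord_sigmaI|].
  apply/seteqP; split=> [x [[xA xB] [xA' xB']]|x [xA xB]].
    by split => k; split.
  by split; split => k; have [] := xA k; have [] := xB k.
- move=> _ [A [B [SA SB ->]]].
  (* [C true] collects the conditions that the preimage puts on the first copy, and [C false] those
     on the second. *)
  pose C (s : bool) k := if (item_of_coord k \in D) == s then A k else B k.
  have SC s k : S k (C s k) by rewrite /C; case: eqP.
  change (QQ (phi @^-1` (rectangle A `*` rectangle B)) = QQ (rectangle A `*` rectangle B)).
  have -> : phi @^-1` (rectangle A `*` rectangle B) =
      rectangle (C true) `*` rectangle (C false).
    apply/seteqP; split=> x [/= x1 x2]; split=> k /=.
    + have := x1 k; have := x2 k; rewrite /= (coord_sigma_mix _ _ _ (SA k)).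
      rewrite (coord_sigma_mix _ _ _ (SB k)) /C inE.
      by case: (_ \in D).
    + have := x1 k; have := x2 k; rewrite /= (coord_sigma_mix _ _ _ (SA k)).
      rewrite (coord_sigma_mix _ _ _ (SB k)) /C inE.
      by case: (_ \in D).
    + have := x1 k; have := x2 k; rewrite /= (coord_sigma_mix _ _ _ (SA k)) /C inE.
      by case: (_ \in D).
    + have := x1 k; have := x2 k; rewrite /= (coord_sigma_mix _ _ _ (SB k)) /C.
      by case: (_ \in D).
  rewrite !probability_rectangleX// -!big_split; apply: eq_bigr => k _ /=; rewrite /C.
  by case: (_ \in D) => //=; rewrite muleC.
- move=> _; change (QQ setT < +oo)%E.
  by rewrite -[ltLHS]/(QQ setT) probability_setT ltry.
- exact: rectangles_generate.
Qed.

End Law.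

(** * Edges of simple paths and the probability of a contact path *)

Section PathEdges.
Context {R : realType} {n : nat}.

Definition pair_weight (K : R) (W : 'I_n -> R) (xy : 'I_n * 'I_n) : R :=
  W xy.1 * W xy.2 * K.

Definition path_weight (K : R) (W : 'I_n -> R) (v : 'I_n) (p : seq 'I_n) : R :=
  \prod_(xy <- zip (v :: p) p) pair_weight K W xy.

(** The edge probability before truncation at 1, when [K] is 1 / (n theta). *)
Definition edge_weight (K : R) (W : 'I_n -> R) (e : edge n) : R :=
  (\prod_(u in val e) W u) * K.

Lemma edge_exists (x y : 'I_n) : x != y -> {e : edge n | val e = [set x; y]%SET}.
Proof.
move=> xy; have c2 : #|[set x; y]%SET| == 2%N by rewrite cards2 xy.
by exists (exist (fun e : {set 'I_n} => #|e| == 2%N) _ c2).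
Qed.

Lemma edge_weightE K W (e : edge n) x y : x != y -> val e = [set x; y]%SET ->
  edge_weight K W e = pair_weight K W (x, y).
Proof.
move=> xy ee; rewrite /edge_weight ee big_setU1 ?big_set1//=.
by rewrite inE.
Qed.

Lemma adj_edge F (c : config R n) (e : edge n) x y : val e = [set x; y]%SET ->
  adj (graphF F c) x y = bit F e c.
Proof.
move=> ee; rewrite adj_graphF; apply/existsP/idP => [[e' /andP[be' /eqP e'E]]|be].
  by rewrite (_ : e = e')//; apply: val_inj; rewrite ee e'E.
by exists e; rewrite be ee eqxx.
Qed.

Lemma path_edges K W v p : uniq (v :: p) -> exists L : seq (edge n),
  [/\ uniq L, (forall e, e \in L -> {subset val e <= v :: p}),
      (forall F (c : config R n), path (adj (graphF F c)) v p = all (fun e => bit F e c) L) &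
      \prod_(e <- L) edge_weight K W e = path_weight K W v p].
Proof.
elim: p v => [|y p IHp] v; first by exists [::]; split; rewrite /path_weight/= ?big_nil.
move=> /= /andP[vyp uyp]; have [L [uL subL pathL prodL]] := IHp y uyp.
have vy : v != y by apply: contraNneq vyp => ->; rewrite mem_head.
have [e0 e0E] := edge_exists vy; exists (e0 :: L); split.
- rewrite /= uL andbT; apply: contra vyp => /subL; apply.
  by rewrite e0E !inE eqxx.
- move=> e; rewrite in_cons => /orP[/eqP->|/subL sub] u.
    by rewrite e0E !inE => /orP[/eqP->|/eqP->]; rewrite eqxx ?orbT.
  by move=> /sub uyp'; rewrite in_cons uyp' orbT.
- by move=> F c /=; rewrite (adj_edge F c e0E) pathL.
- by rewrite /path_weight/= !big_cons prodL (edge_weightE K W vy e0E).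
Qed.

End PathEdges.

Section ContactProbability.
Context {R : realType} {n : nat} (Q : probability (config R n) R).
Variables (theta : R) (W : 'I_n -> R) (muV muE : probability R R).
Hypothesis indep : mutually_independent Q (@coord_sigma R n).
Hypothesis law1 : has_graph_law theta W muV muE Q fst.
Hypothesis law2 : has_graph_law theta W muV muE Q snd.
Hypotheses (theta_gt0 : 0 < theta) (W_gt0 : forall v, 0 < W v).
Local Notation K := ((n%:R * theta)^-1).

(** Each edge is looked up once, in X or in X' according to its set. Distinct edges use distinct,
    hence independent, coordinates, and both halves have the same edge probabilities. *)
Lemma probability_bits (L : seq (edge n * {set item n})) : uniq (map fst L) ->
  (Q [set c | all (fun t => bit t.2 t.1 c) L] =
   \prod_(t <- L) (edge_prob theta W t.1)%:E)%E.
Proof.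
move=> uL.
pose kk (t : edge n * {set item n}) : (edge n + item n) + (edge n + item n) :=
  if inr t.1 \in t.2 then inr (inl t.1) else inl (inl t.1).
pose A (k : (edge n + item n) + (edge n + item n)) : set (config R n) :=
  match k with
  | inl (inl e) => [set c : config R n | c.1.1 e]
  | inr (inl e) => [set c : config R n | c.2.1 e]
  | _ => setT
  end.
have SA k : coord_sigma k (A k).
  by case: k => -[e|z]; first [exact: coord_sigmaT | exists [set true]; rewrite ?setTI].
have ukk : uniq (map kk L).
  (* [g] recovers the edge from its coordinate, so distinct edges have distinct coordinates. *)
  pose g (k : (edge n + item n) + (edge n + item n)) : option (edge n) :=
    match k with inl (inl e) | inr (inl e) => Some e | _ => None end.
  apply: (@map_uniq _ _ g); rewrite -map_comp.
  rewrite (_ : map _ L = map Some (map fst L)).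
    by rewrite map_inj_uniq// => a b [].
  by rewrite -map_comp; apply: eq_map => -[e F]; rewrite /kk/=; case: ifP.
have AE t c : A (kk t) c = bit t.2 t.1 c.
  by rewrite /kk /bit; case: ifP.
have QA t : Q (A (kk t)) = (edge_prob theta W t.1)%:E.
  have [l1 _ _] := law1; have [l2 _ _] := law2.
  by rewrite /kk; case: ifP => _; [rewrite -l2|rewrite -l1].
transitivity (Q (\bigcap_(k in [set` [set k in map kk L]%SET]) A k)).
  congr (Q _); apply/seteqP; split => [c /allP cL k|c cL].
    by rewrite /= inE => /mapP[t tL ->]; rewrite AE; exact: cL.
  by apply/allP => t tL; rewrite -AE; apply: cL; rewrite /= inE map_f.
rewrite indep//; under eq_bigl do rewrite inE.
by rewrite -big_uniq//= big_map; apply: eq_bigr => t _; exact: QA.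
Qed.

Let K_ge0 : 0 <= K.
Proof. by rewrite invr_ge0 mulr_ge0// ltW. Qed.

Lemma edge_prob_le e : 0 <= edge_prob theta W e <= edge_weight K W e.
Proof.
rewrite /edge_prob ge_min lexx le_min ler01 andbT orTb andbT.
by rewrite mulr_ge0// prodr_ge0// => u _; exact: ltW.
Qed.

Lemma probability_bits_le (L : seq (edge n * {set item n})) : uniq (map fst L) ->
  (Q [set c | all (fun t => bit t.2 t.1 c) L] <=
   (\prod_(e <- map fst L) edge_weight K W e)%:E)%E.
Proof.
move=> uL; rewrite probability_bits// big_map prodEFin lee_fin.
by apply: ler_prod => t _; exact: edge_prob_le.
Qed.

Lemma probability_contact_path F1 F2 F3 o v v' p p' :
  ((Q \x Q) [set x | contact_path F1 F2 F3 o v v' p p' x.1 x.2] <=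
   (path_weight K W v p * path_weight K W v' p' *
    pair_weight K W (last v p, last v' p'))%:E)%E.
Proof.
have W0 v1 : 0 <= W v1 by exact: ltW.
have pair0 xy : 0 <= pair_weight K W xy by rewrite !mulr_ge0.
have [uvp|nuvp] := boolP (uniq ((v :: p) ++ (v' :: p'))); last first.
  rewrite (_ : [set x | _] = set0) ?measure0 ?lee_fin ?mulr_ge0 ?prodr_ge0//.
  by apply/seteqP; split=> // x /=; rewrite /contact_path (negbTE nuvp).
have := uvp; rewrite cat_uniq => /and3P[uv /hasPn disj uv'].
have [L1 [uL1 sub1 path1 <-]] := path_edges K W uv.
have [L2 [uL2 sub2 path2 <-]] := path_edges K W uv'.
have ll : last v p != last v' p'.
  by apply: contraTneq (disj _ (mem_last _ _)) => <-; rewrite negbK; exact: mem_last.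
have [e eE] := edge_exists ll.
rewrite -(edge_weightE K W ll eE).
pose L := [seq (e', F1) | e' <- L1] ++ [seq (e', F2) | e' <- L2].
have LE : map fst L = L1 ++ L2 by rewrite map_cat -!map_comp !map_id.
(* The edges of each list stay within the vertices of one path and the paths are disjoint, so the
   lists share no edge; [e] has an end on each path and so lies in neither. *)
have uL : uniq (e :: L1 ++ L2).
  have eL1 : e \notin L1.
    apply/negP => /sub1/(_ (last v' p')); rewrite eE !inE eqxx orbT => /(_ isT) h.
    by have := disj _ (mem_last v' p'); rewrite /= inE h.
  have eL2 : e \notin L2.
    apply/negP => /sub2/(_ (last v p)); rewrite eE !inE eqxx => /(_ isT) h.
    by have := disj (last v p); rewrite inE h => /(_ isT); rewrite mem_last.
  rewrite cons_uniq mem_cat negb_or eL1 eL2 cat_uniq uL1 uL2 !andTb andbT.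
  apply/hasPn => e' e'2; apply/negP => /sub1 s1.
  have /card_gt0P[u ue'] : (0 < #|val e'|)%N by rewrite (eqP (valP e')).
  by have := disj u (sub2 _ e'2 _ ue'); rewrite /= (s1 _ ue').
have allL (c : config R n) : all (fun t => bit t.2 t.1 c) L =
    path (adj (graphF F1 c)) v p && path (adj (graphF F2 c)) v' p'.
  by rewrite all_cat !all_map path1 path2.
have mbits L' : measurable [set c : config R n | all (fun t => bit t.2 t.1 c) L'].
  apply: measurable_preim_true; apply: measurable_fun_all => t.
  exact: measurable_fun_bit.
(* The contact event is a product of an event on [c] and one on [c']; [o] decides which of them
   receives the joining edge. *)
pose A1 := [set c : config R n | all (fun t => bit t.2 t.1 c) (if o then (e, F3) :: L else L)].
pose A2 := [set c : config R n | all (fun t => bit t.2 t.1 c) (if o then [::] else [:: (e, F3)])].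
have cE (c c' : config R n) : contact_path F1 F2 F3 o v v' p p' c c' =
    all (fun t => bit t.2 t.1 c) (if o then (e, F3) :: L else L) &&
    all (fun t => bit t.2 t.1 c') (if o then [::] else [:: (e, F3)]).
  rewrite /contact_path uvp (adj_edge _ _ eE); case: (o).
    transitivity (bit F3 e c && all (fun t => bit t.2 t.1 c) L); last by rewrite andbT.
    by rewrite allL andTb andbA andbC.
  by rewrite allL all_seq1 andTb andbA.
rewrite (_ : [set x | _] = A1 `*` A2); last first.
  by apply/seteqP; split=> -[c c'] /=; rewrite cE => /andP.
rewrite product_measure1E; [|exact: mbits|exact: mbits].
pose w (L' : seq (edge n * {set item n})) : R := \prod_(e' <- map fst L') edge_weight K W e'.
have QA1 : (Q A1 <= (w (if o then (e, F3) :: L else L))%:E)%E.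
  by apply: probability_bits_le; case: (o); rewrite ?map_cons LE//; case/andP: uL.
have QA2 : (Q A2 <= (w (if o then [::] else [:: (e, F3)]))%:E)%E.
  by apply: probability_bits_le; case: (o).
apply: le_trans (lee_pmul _ _ QA1 QA2) _ => //.
rewrite -EFinM lee_fin /w; case: (o); rewrite /= ?big_cons ?big_nil LE big_cat/= ?mulr1//.
by rewrite [leRHS]mulrC.
Qed.

End ContactProbability.

(** * Summation over paths and the covariance bound *)

Section CovarianceBound.
Context {R : realType} {n : nat} (Q : probability (config R n) R).
Variables (theta : R) (W : 'I_n -> R) (muV muE : probability R R).
Hypothesis indep : mutually_independent Q (@coord_sigma R n).
Hypothesis law1 : has_graph_law theta W muV muE Q fst.
Hypothesis law2 : has_graph_law theta W muV muE Q snd.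
Hypotheses (theta_gt0 : 0 < theta) (W_gt0 : forall v, 0 < W v).
Local Notation K := ((n%:R * theta)^-1).
Local Notation Gam2 := (Gam theta W 2).

Let K_ge0 : 0 <= K.
Proof. by rewrite invr_ge0 mulr_ge0// ltW. Qed.

Lemma Gam_ge0 p : 0 <= Gam theta W p.
Proof. by rewrite mulr_ge0// sumr_ge0// => u _; rewrite exprn_ge0// ltW. Qed.

(** The factor W of the last vertex is this path's share of the joining edge, so a contact bound
    factors as [K] times two walk weights. *)
Definition walk_weight v p : R := path_weight K W v p * W (last v p).

(** The empty walk contributes W_v. Summing over the first step x gives W_v K W_x times at most W_x
    (1 + Gamma_2)^l, in total W_v Gamma_2 (1 + Gamma_2)^l; together they are at most W_v (1 +
    Gamma_2)^(l+1), since (1 + Gamma_2)^l >= 1. *)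
Lemma sum_walk_weight l v :
  0 <= \sum_(p <- walks n l) walk_weight v p <= W v * (1 + Gam2) ^+ l.
Proof.
have W0 u : 0 <= W u by exact: ltW.
have G0 := Gam_ge0 2.
apply/andP; split.
  rewrite sumr_ge0// => p _; rewrite mulr_ge0// prodr_ge0// => xy _.
  by rewrite !mulr_ge0.
elim: l v => [|l IHl] v.
  by rewrite big_seq1 /walk_weight /path_weight big_nil mul1r mulr1.
rewrite big_cons big_allpairs_dep /= {1}/walk_weight /path_weight big_nil mul1r.
have step x p : walk_weight v (x :: p) = pair_weight K W (v, x) * walk_weight x p.
  by rewrite /walk_weight /path_weight big_cons mulrA.
under eq_bigr do under eq_bigr do rewrite step.
under eq_bigr do rewrite -mulr_sumr.
have le1 : \sum_(x <- enum 'I_n) pair_weight K W (v, x) *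
    (\sum_(p <- walks n l) walk_weight x p) <= W v * (Gam2 * (1 + Gam2) ^+ l).
  rewrite big_enum/= /Gam -mulrA mulr_suml 2!mulr_sumr ler_sum// => x _.
  rewrite /pair_weight/=.
  apply: le_trans (ler_wpM2l _ (IHl x)) _; first by rewrite !mulr_ge0.
  by rewrite expr2 le_eqVlt; apply/orP; left; apply/eqP; ring.
apply: le_trans (lerD (lexx _) le1) _.
rewrite -[X in X + _]mulr1 -mulrDr ler_pM2l// exprS mulrDl mul1r lerD2r.
by rewrite exprn_ege1// lerDl.
Qed.

Lemma covariance_ball_pairs_le l F F' m m' (v : m.-tuple 'I_n) (v' : m'.-tuple 'I_n)
    (g : m.-tuple (rooted_wgraph R n * rooted_wgraph R n) -> R)
    (g' : m'.-tuple (rooted_wgraph R n * rooted_wgraph R n) -> R) :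
  uniq (v ++ v') -> measurable_fun setT g -> measurable_fun setT g' ->
  (forall b, `|g b| <= 1) -> (forall b, `|g' b| <= 1) ->
  (covariance Q (g \o ball_pairs l F v) (g' \o ball_pairs l F' v') <=
   (32 * (K * \sum_(i < m) \sum_(j < m') W (tnth v i) * W (tnth v' j)) *
    (1 + Gam2) ^+ (2 * l))%:E)%E.
Proof.
move=> uvv mg mg' g1 g1'.
have mB m0 F0 (v0 : m0.-tuple 'I_n) := measurable_ball_pairs l F0 v0 (@measurable_id _ (config R n) setT).
pose N := size (walks n l).
pose wk (a : 'I_N) := tnth (in_tuple (walks n l)) a.
(* Possible contacts are indexed by the two roots, the switches s, s', t, o, and the positions of
   the two paths in the list of walks. *)
pose I := ('I_m * 'I_m' * (bool * bool * bool * bool) * ('I_N * 'I_N))%type.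
pose E (k : I) : set (config R n * config R n) :=
  let: (i, j, (s, s', t, o), (a, b)) := k in
  [set x | contact_path (only_if s F) (only_if s' F') (only_if t [set: item n]%SET) o
             (tnth v i) (tnth v' j) (wk a) (wk b) x.1 x.2].
pose w (k : I) : R :=
  K * (walk_weight (tnth v k.1.1.1) (wk k.2.1) * walk_weight (tnth v' k.1.1.2) (wk k.2.2)).
have mE k : measurable (E k).
  by case: k => -[[i j] [[[s s'] t] o]] [a b]; exact: measurable_contact_path.
have Ew k : ((Q \x Q) (E k) <= (w k)%:E)%E.
  case: k => -[[i j] [[[s s'] t] o]] [a b].
  apply: le_trans (probability_contact_path indep law1 law2 theta_gt0 W_gt0 _ _ _ _ _ _ _ _) _.
  rewrite lee_fin /w /walk_weight /pair_weight/= le_eqVlt; apply/orP; left; apply/eqP.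
  by ring.
apply: (@le_trans _ _ (\sum_k (2%:E * (Q \x Q) (E k)))%E).
  apply: (@covariance_le_union _ _ _ Q {set 'I_n} (ball_region l F v)
    (fun u x => mix (~: items_of u)%SET x.1 x.2) (fun u x => mix (items_of u) x.1 x.2)).
  - move=> u; have := measurable_preim_true
      (measurable_ball_region l F v u (@measurable_id _ (config R n) setT)).
    by congr measurable; apply/seteqP; split=> c /= /eqP.
  - by move=> u; apply: measurable_fun_mix.
  - by move=> u; apply: measurable_fun_mix.
  - by move=> u A mA; exact: mix_invariant.
  - by move=> u x; exact: ball_region_mix.
  - exact: measurableT_comp mg (mB _ _ _).
  - exact: measurableT_comp mg' (mB _ _ _).
  - by move=> c; exact: g1.
  - by move=> c; exact: g1'.
  - by move=> u x ux; rewrite /= ball_pairs_mix.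
  - exact: mE.
  - move=> x nE; rewrite /= ball_pairs_no_contact// => -[i [j [s [s' [t [oo [p [p' []]]]]]]]].
    rewrite -!mem_walks => pl p'l h.
    have /tnthP[a pa] : p \in in_tuple (walks n l) by [].
    have /tnthP[b pb] : p' \in in_tuple (walks n l) by [].
    by apply: (nE (i, j, (s, s', t, oo), (a, b))); rewrite /E /wk /= -pa -pb.
apply: (@le_trans _ _ (\sum_k (2 * w k)%:E)%E).
  by apply: lee_sum => k _; rewrite EFinM lee_pmul2l.
rewrite sumEFin lee_fin -mulr_sumr.
have -> : \sum_k w k = \sum_i \sum_j \sum_(f : bool * bool * bool * bool)
   (K * ((\sum_(p <- walks n l) walk_weight (tnth v i) p) *
         (\sum_(p <- walks n l) walk_weight (tnth v' j) p))).
  have inner i j : K * ((\sum_(p <- walks n l) walk_weight (tnth v i) p) *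
        (\sum_(p <- walks n l) walk_weight (tnth v' j) p)) =
      \sum_(y : 'I_N * 'I_N)
        K * (walk_weight (tnth v i) (wk y.1) * walk_weight (tnth v' j) (wk y.2)).
    rewrite !(big_tnth _ _ (walks n l)) big_distrlr/= mulr_sumr.
    by under [LHS]eq_bigr => a _ do rewrite mulr_sumr; rewrite pair_bigA.
  under [RHS]eq_bigr do under eq_bigr do under eq_bigr do rewrite inner.
  by rewrite !pair_bigA.
(* 32 is 2, from the decoupled difference, times the 16 values of the four switches. *)
have -> : 32 * (K * \sum_(i < m) \sum_(j < m') W (tnth v i) * W (tnth v' j)) *
    (1 + Gam2) ^+ (2 * l) =
  2 * \sum_(i < m) \sum_(j < m') \sum_(f : bool * bool * bool * bool)
    (K * ((W (tnth v i) * (1 + Gam2) ^+ l) * (W (tnth v' j) * (1 + Gam2) ^+ l))).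
  rewrite mulnC exprM expr2; set x := (1 + Gam2) ^+ l.
  rewrite mulr_sumr -!mulrA mulr_sumr mulr_suml mulr_sumr; apply: eq_bigr => i _.
  rewrite !mulr_sumr mulr_suml !mulr_sumr; apply: eq_bigr => j _.
  rewrite sumr_const !card_prod card_bool -mulr_natl -[(2 * 2 * 2 * 2)%N]/16%N.
  by ring.
rewrite ler_pM2l//; apply: ler_sum => i _; apply: ler_sum => j _; apply: ler_sum => f _.
rewrite ler_wpM2l//.
have /andP[a0 aw] := sum_walk_weight l (tnth v i).
have /andP[b0 bw] := sum_walk_weight l (tnth v' j).
exact: ler_pM.
Qed.

End CovarianceBound.

(** * From the conditional law to the stated bound *)

Theorem lemma3p26 (R : realType) :
  exists2 C : R, 0 < C &
  forall (d : nat -> measure_display) (T : forall n, measurableType (d n))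
    (P : forall n, probability (T n) R) (theta : R)
    (W : forall n, 'I_n -> {RV (P n) >-> R})
    (muV muE : nat -> probability R R)
    (Z : forall n, {RV (P n) >-> config R n})
    (kappa : forall n, T n -> probability (config R n) R),
  rank_one_model theta W muV muE Z kappa ->
  forall (n m m' : nat) (v : m.-tuple 'I_n) (v' : m'.-tuple 'I_n)
    (F F' : {set item n}) (l : nat),
  uniq (v ++ v') ->
  let entry w : R :=
    (\sum_(i < m) \sum_(j < m')
       (W n (tnth v i) w + 1) * (W n (tnth v' j) w + 1)) / (n%:R * theta)
    * (Gam theta (W n ^~ w) 3 + 1)
    * (Gam theta (W n ^~ w) 2 + C) ^+ (2 * l + 1) in
  let V := [set u in v]%SET in
  let V' := [set u in v']%SET in
  {ae P n, forall w,
     (sup_cov (kappa n w) (ball_pairs l F v) (ball_pairs l F' v')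
      <= (Num.min (entry w) 1)%:E)%E} /\
  (forall w, entry w =
     (wnorm (W n ^~ w) V + #|V|%:R) * (wnorm (W n ^~ w) V' + #|V'|%:R)
     / (n%:R * theta)
     * (Gam theta (W n ^~ w) 3 + 1)
     * (Gam theta (W n ^~ w) 2 + C) ^+ (2 * l + 1)).
Proof.
exists 32 => // d T P theta W muV muE Z kappa model n m m' v v' F F' l uvv entry V V'.
have theta0 := theta_gt0 model; have W0 := @weight_gt0 _ _ _ _ _ _ _ _ _ _ model n.
split=> [|w].
  (* The exceptional null set comes from the conditional law alone, so one null set serves all test
     functions and the supremum can be taken pointwise. *)
  apply: filterS2 (kappa_independent model n) (kappa_law model n) => w indep [law1 law2].
  apply: ge_ereal_sup => _ [g [g' [mg mg' g1 g1' ->]]].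
  have W1 u : 0 < W n u w by exact: W0.
  rewrite EFin_min le_min; apply/andP; split; last first.
    apply: covariance_le1 => [||b|b]; [| |exact: g1|exact: g1'].
      exact: measurableT_comp mg (measurable_ball_pairs _ _ _ (@measurable_id _ _ setT)).
    exact: measurableT_comp mg' (measurable_ball_pairs _ _ _ (@measurable_id _ _ setT)).
  apply: le_trans (covariance_ball_pairs_le indep law1 law2 theta0 W1 l F F' uvv mg mg' g1 g1') _.
  have G2 := Gam_ge0 theta0 W1 2; have G3 := Gam_ge0 theta0 W1 3.
  (* Nonnegativity covers n = 0 as well, where the inverse is 0 by convention. *)
  have K0 : 0 <= (n%:R * theta)^-1 by rewrite invr_ge0 mulr_ge0// ltW.
  rewrite lee_fin /entry; set K := (n%:R * theta)^-1 in K0 *.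
  set G := Gam theta (W n ^~ w) 2 in G2 *.
  set S := \sum_(i < m) \sum_(j < m') _; set S' := \sum_(i < m) \sum_(j < m') _.
  have S0 : 0 <= S.
    by apply: sumr_ge0 => i _; apply: sumr_ge0 => j _; rewrite mulr_ge0// ltW.
  have SS' : S <= S'.
    apply: ler_sum => i _; apply: ler_sum => j _.
    by apply: ler_pM; rewrite ?lerDl// ltW.
  have X0 : 0 <= (1 + G) ^+ (2 * l) by rewrite exprn_ge0// addr_ge0.
  (* The odd exponent supplies one extra factor [G + 32], which absorbs the constant 32. *)
  have XY : 32 * (1 + G) ^+ (2 * l) <= (G + 32) ^+ (2 * l + 1).
    rewrite addn1 exprS ler_pM//; first by rewrite lerDr.
    by rewrite lerXn2r ?nnegrE ?addr_ge0// addrC lerD2l ler1n.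
  set X := (1 + G) ^+ (2 * l) in X0 XY *.
  rewrite (_ : 32 * (K * S) * X = S * K * 1 * (32 * X)); last by ring.
  apply: ler_pM => //; rewrite ?mulr_ge0//.
  apply: ler_pM => //; [exact: mulr_ge0|exact: ler_wpM2r|by rewrite lerDr].
rewrite /entry; congr (_ / _ * _ * _).
(* Distinct entries let the sum over the vertex set be read along the tuple, each vertex
   contributing its weight plus 1. *)
have sumE k (u : k.-tuple 'I_n) : uniq u ->
    wnorm (W n ^~ w) [set x in u]%SET + #|[set x in u]%SET|%:R =
    \sum_(i < k) (W n (tnth u i) w + 1).
  move=> uu; rewrite /wnorm -sum1_card natr_sum -big_split/=.
  under eq_bigl do rewrite inE.
  by rewrite -big_uniq// big_tuple.
move: uvv; rewrite cat_uniq => /and3P[uv _ uv'].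
by rewrite !sumE// big_distrlr.
Qed.
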